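(* Let $p \ge 1$ be a real number. Consider the linear program: minimize $\bm{c}^{\top}\bm{x}$ subject to $\bm{A}\bm{x}=\bm{b}$, $\bm{x}\ge\bm{0}$, with $\bm{A}\in\mathbb{R}^{m\times n}$, $\bm{b}\in\mathbb{R}^m$, $\bm{c}\in\mathbb{R}^n$, under the standing assumptions listed in the context (in particular, the linear program is nondegenerate and the initial basic feasible solution $\bm{x}^0$ is not optimal). Then the simplex method with the $p$-norm rule, started from $\bm{x}^0$, finds an optimal solution in at most $$\left\lceil m^{1+\frac{1}{p}}\, \frac{\gamma^2}{\delta^2}\, \log\left(\frac{\bm{c}^{\top}\bm{x}^0 - z^*}{\bm{c}^{\top}\bar{\bm{x}} - z^*}\right)\right\rceil$$ iterations.
   Context: Linear program and dictionaries. Put $\ell=n-m$. A basis is a set $B\subset\{1,\dots,n\}$ with $|B|=m$ such that the submatrix $\bm{A}_B$ of columns indexed by $B$ is nonsingular; $N=\{1,\dots,n\}\setminus B$ is the corresponding nonbasis. The dictionary for $B$ is: minimize $z_0+\bar{\bm{c}}_N^{\top}\bm{x}_N$ subject to $\bm{x}_B=\bar{\bm{b}}-\bar{\bm{A}}_N\bm{x}_N$, $\bm{x}\ge\bm{0}$, where $z_0=\bm{c}_B^{\top}\bm{A}_B^{-1}\bm{b}$, $\bar{\bm{c}}_N=\bm{c}_N-\bm{A}_N^{\top}(\bm{A}_B^{\top})^{-1}\bm{c}_B$ (reduced costs), $\bar{\bm{b}}=\bm{A}_B^{-1}\bm{b}$, $\bar{\bm{A}}_N=\bm{A}_B^{-1}\bm{A}_N$.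 Write $B=\{i_1,\dots,i_m\}$, $N=\{j_1,\dots,j_\ell\}$, $\bar{\bm{b}}=(\bar b_1,\dots,\bar b_m)^{\top}$, $\bar{\bm{c}}_N=(\bar c_1,\dots,\bar c_\ell)^{\top}$, $\bar{\bm{A}}_N=(\bar a_{ik})$. The basic solution of $B$ is $(\bm{x}_B,\bm{x}_N)=(\bar{\bm{b}},\bm{0})$; it is a basic feasible solution (BFS), and $B$ and $N$ are called feasible, if $\bar{\bm{b}}\ge\bm{0}$. Simplex method. Given a feasible dictionary, if $\bar{\bm{c}}_N\ge\bm{0}$ the current BFS is optimal and the method stops. Otherwise a pivoting rule chooses an entering variable $x_{j_s}$ with $\bar c_s<0$; its value is increased from $0$ to $\theta_s=\min\{\bar b_k/\bar a_{ks} : \bar a_{ks}>0,\ k=1,\dots,m\}$, and, with $r$ an index attaining this minimum, $x_{i_r}$ leaves the basis and $x_{j_s}$ enters it. This exchange is one iteration. $p$-norm rule. Let $(\bm{v}_N)_k$ be the $k$-th column of the $n\times\ell$ matrix $\bm{V}_N=\begin{bmatrix}-\bar{\bm{A}}_N\\ \bm{I}\end{bmatrix}$, with $\bm{I}$ the $\ell\times\ell$ identity, so $\|(\bm{v}_N)_k\|_p=(1+\sum_{i=1}^m|\bar a_{ik}|^p)^{1/p}$. The $p$-norm rule chooses the entering variable $x_{j_s}$ with $s\in\mathrm{argmin}_k\{\bar c_k/\|(\bm{v}_N)_k\|_p : k=1,\dots,\ell\}$. (For $p=2$ it is the steepest-edge rule.) Standing assumptions. $\mathrm{rank}\,\bm{A}=m$;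 an initial BFS $\bm{x}^0$ is available; the linear program and its dual (maximize $\bm{b}^{\top}\bm{y}$ subject to $\bm{A}^{\top}\bm{y}+\bm{s}=\bm{c}$, $\bm{s}\ge\bm{0}$) have optimal basic solutions, with common optimal value $z^*$; $\bm{x}^0$ is not optimal, i.e. $\bm{c}^{\top}\bm{x}^0>z^*$; the linear program is nondegenerate, i.e. each basic variable has a positive value in every BFS. Further notation. $\gamma$ and $\delta$ are respectively the maximum and the minimum among all positive components of all BFSs. $\bar{\bm{x}}$ is a second optimal BFS, i.e. a BFS whose objective value is the smallest among the BFSs that are not optimal. $\log$ is the natural logarithm.
   Formalization: The bound is the maximum of 1 and the stated ceiling: when the initial basic feasible solution has the same objective value as the second optimal one, the ceiling is 0 although one iteration is needed; in all other cases the bound is as stated. *)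

(* Defs.v *)
From HB Require Import structures.
From mathcomp Require Import all_boot all_order all_algebra.
From mathcomp Require Import all_classical all_reals all_analysis.

Set Implicit Arguments.
Unset Strict Implicit.
Unset Printing Implicit Defensive.

Import Order.TTheory GRing.Theory Num.Theory.
Local Open Scope classical_set_scope.
Local Open Scope ring_scope.

Definition dotv (R : realType) (q : nat) (u v : 'cV[R]_q) : R :=
  (u^T *m v) 0 0.

Definition nonnegv (R : realType) (q : nat) (v : 'cV[R]_q) : Prop :=
  forall i, 0 <= v i 0.

Definition pnorm (R : realType) (p : R) (q : nat) (v : 'cV[R]_q) : R :=
  (\sum_(i < q) `|v i 0| `^ p) `^ p^-1.

Definition maximum (R : realType) (S : set R) (t : R) : Prop :=
  S t /\ ubound S t.

Definition minimum (R : realType) (S : set R) (t : R) : Prop :=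
  S t /\ lbound S t.

(* i_1 < ... < i_m : the elements of a set of m indices, in increasing order. *)
Definition set_idx (n m : nat) (S : {set 'I_n}) (hS : #|S| = m) (k : 'I_m) :
  'I_n := enum_val (cast_ord (esym hS) k).

Record lp_basis (R : realType) (m n : nat) (A : 'M[R]_(m, n)) := Basis {
  bset :> {set 'I_n};
  bset_card : #|bset| = m;
  bset_unit : colsub (set_idx bset_card) A \in unitmx
}.

Lemma nonbasis_card (R : realType) (m n : nat) (A : 'M[R]_(m, n))
  (B : lp_basis A) : #|(~: bset B)%SET| = (n - m)%N.
Proof. by rewrite cardsCs finset.setCK card_ord bset_card. Qed.

Section Dictionary.
Context (R : realType) (m n : nat) (A : 'M[R]_(m, n)).
Context (b : 'cV[R]_m) (c : 'cV[R]_n) (B : lp_basis A).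

Definition bidx : 'I_m -> 'I_n := set_idx (bset_card B).
Definition nidx : 'I_(n - m) -> 'I_n := set_idx (nonbasis_card B).

Definition mxB : 'M[R]_m := colsub bidx A.
Definition mxN : 'M[R]_(m, n - m) := colsub nidx A.

Definition bbar : 'cV[R]_m := invmx mxB *m b.
Definition Abar : 'M[R]_(m, n - m) := invmx mxB *m mxN.
Definition cbar : 'cV[R]_(n - m) :=
  rowsub nidx c - mxN^T *m (invmx mxB^T *m rowsub bidx c).

(* At most one summand is selected: none if j is nonbasic, and bbar_k if
   j = i_k. *)
Definition basic_sol : 'cV[R]_n :=
  \col_j \sum_(k < m | bidx k == j) bbar k 0.

Definition feasible_basis : Prop := nonnegv bbar.

Definition dual_basic_y : 'cV[R]_m := invmx mxB^T *m rowsub bidx c.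
Definition dual_basic_s : 'cV[R]_n := c - A^T *m dual_basic_y.

Definition Vmx : 'M[R]_(m + (n - m), n - m) := col_mx (- Abar) 1%:M.

(* x_{j_s} may be selected as entering variable by the p-norm rule. *)
Definition pnorm_entering (p : R) (s : 'I_(n - m)) : Prop :=
  cbar s 0 < 0 /\
  forall k, cbar s 0 / pnorm p (col s Vmx) <= cbar k 0 / pnorm p (col k Vmx).

(* x_{i_r} may be selected as leaving variable when x_{j_s} enters. *)
Definition leaving (s : 'I_(n - m)) (r : 'I_m) : Prop :=
  0 < Abar r s /\
  forall k, 0 < Abar k s -> bbar r 0 / Abar r s <= bbar k 0 / Abar k s.

Definition exchange (s : 'I_(n - m)) (r : 'I_m) : {set 'I_n} :=
  (nidx s |: (bset B :\ bidx r))%SET.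

End Dictionary.

Section LinearProgram.
Context (R : realType) (m n : nat) (A : 'M[R]_(m, n)).
Context (b : 'cV[R]_m) (c : 'cV[R]_n).

Definition primal_feasible (x : 'cV[R]_n) : Prop :=
  A *m x = b /\ nonnegv x.

Definition primal_optimal (x : 'cV[R]_n) : Prop :=
  primal_feasible x /\
  forall x', primal_feasible x' -> dotv c x <= dotv c x'.

Definition dual_feasible (y : 'cV[R]_m) (s : 'cV[R]_n) : Prop :=
  A^T *m y + s = c /\ nonnegv s.

Definition dual_optimal (y : 'cV[R]_m) (s : 'cV[R]_n) : Prop :=
  dual_feasible y s /\
  forall y' s', dual_feasible y' s' -> dotv b y' <= dotv b y.

Definition bfs (x : 'cV[R]_n) : Prop :=
  exists B : lp_basis A, feasible_basis b B /\ x = basic_sol b B.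

Definition nondegenerate_lp : Prop :=
  forall B : lp_basis A, feasible_basis b B ->
    forall k, 0 < basic_sol b B (bidx B k) 0.

Definition bfs_positive_components : set R :=
  [set t | 0 < t /\ exists x i, bfs x /\ t = x i 0].

Definition second_optimal_bfs (x : 'cV[R]_n) : Prop :=
  [/\ bfs x, ~ primal_optimal x &
      forall x', bfs x' -> ~ primal_optimal x' -> dotv c x <= dotv c x'].

(* Started from the feasible basis B, the simplex method with the p-norm rule
   stops at an optimal solution after at most k iterations, however the ties in
   the choices of s and r are broken; in particular it never gets stuck (for
   lack of an admissible s or r, or because the exchange fails to yield a
   basis). *)
Fixpoint finds_optimum_within (p : R) (k : nat) (B : lp_basis A) : Prop :=
  (nonnegv (cbar c B) /\ primal_optimal (basic_sol b B)) \/
  (if k is k'.+1 then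
     [/\ exists s, pnorm_entering c B p s,
         forall s, pnorm_entering c B p s -> exists r, leaving b B s r &
         forall s r, pnorm_entering c B p s -> leaving b B s r ->
           exists2 B' : lp_basis A,
             bset B' = exchange B s r & finds_optimum_within p k' B']
   else False).

End LinearProgram.

(* Main.v *)
(* Let Delta < 0 be the minimal ratio cbar_k / ||v_k||_p.  Moving along an edge k
   with cbar_k < 0 reaches another basic feasible solution after a step of length
   at least delta, while every basic variable stays in [0, gamma]; hence
   |abar_ik| <= gamma / delta and ||v_k||_p <= (m+1)^(1/p) gamma / delta.  Since
   an optimal basic solution has at most m nonzero entries, all at most gamma,
   the gap to the optimal value is at most
   (-Delta) m (m+1)^(1/p) gamma^2 / delta.  In the pivot, the entering and the
   leaving variable both change by at least delta, so the objective decreases by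
   at least (-Delta) 2^(1/p) delta.  As m+1 <= 2m, one iteration multiplies the
   gap by at most 1 - 1/K, with K = m^(1+1/p) gamma^2 / delta^2.  The current
   solution is optimal once its gap drops below that of xbar. *)

Require Import Defs.
From HB Require Import structures.
From mathcomp Require Import all_boot all_order all_algebra.
From mathcomp Require Import all_classical all_reals all_analysis.
From mathcomp Require Import ring lra.

Set Implicit Arguments.
Unset Strict Implicit.
Unset Printing Implicit Defensive.

Import Order.TTheory GRing.Theory Num.Theory.
Local Open Scope ring_scope.

(** * Enumerating index sets and testing invertibility *)

Section SetIdx.
Context (n m : nat) (S : {set 'I_n}) (hS : #|S| = m).

Lemma set_idx_inj : injective (set_idx hS).
Proof. by move=> k l /enum_val_inj/cast_ord_inj. Qed.

Lemma set_idx_in k : set_idx hS k \in S.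
Proof. exact: enum_valP. Qed.

Lemma set_idx_surj j : j \in S -> exists k, set_idx hS k = j.
Proof.
move=> jS; exists (cast_ord hS (enum_rank_in jS j)).
by rewrite /set_idx cast_ordK enum_rankK_in.
Qed.

Lemma sum_set_idx (V : nmodType) (f : 'I_n -> V) :
  \sum_k f (set_idx hS k) = \sum_(j in S) f j.
Proof.
rewrite [RHS]big_enum_val [RHS](reindex (cast_ord (esym hS))) //=.
by exists (cast_ord hS) => i _; rewrite ?cast_ordK ?cast_ordKV.
Qed.

End SetIdx.

Lemma unitmx_inj (F : fieldType) (m : nat) (M : 'M[F]_m) :
  (forall v : 'cV_m, M *m v = 0 -> v = 0) -> M \in unitmx.
Proof.
move=> Minj; rewrite -unitmx_tr -row_free_unit; apply: inj_row_free => v.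
by move=> /(congr1 trmx); rewrite trmx_mul trmxK trmx0 => /Minj/(congr1 trmx);
  rewrite trmxK trmx0.
Qed.

(** * Basic and nonbasic indices, dictionaries, basic solutions *)

Section DictionaryTheory.
Context (R : realType) (m n : nat) (A : 'M[R]_(m, n)).
Context (b : 'cV[R]_m) (c : 'cV[R]_n).
Implicit Types (B : lp_basis A) (x : 'cV[R]_n).

Lemma bidx_inj B : injective (bidx B). Proof. exact: set_idx_inj. Qed.
Lemma nidx_inj B : injective (nidx B). Proof. exact: set_idx_inj. Qed.

Lemma bidx_in B k : bidx B k \in bset B. Proof. exact: set_idx_in. Qed.

Lemma nidx_notin B k : nidx B k \notin bset B.
Proof. by have := set_idx_in (nonbasis_card B) k; rewrite inE. Qed.

Lemma bidx_neq_nidx B k l : (bidx B k == nidx B l) = false.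
Proof. by apply/negP => /eqP e; have := nidx_notin B l; rewrite -e bidx_in. Qed.

Lemma bidx_nidxP B j : (exists k, j = bidx B k) \/ (exists k, j = nidx B k).
Proof.
have [jB|jB] := boolP (j \in bset B).
  by left; have [k <-] := set_idx_surj (bset_card B) jB; exists k.
have jN : j \in (~: bset B)%SET by rewrite inE.
by right; have [k <-] := set_idx_surj (nonbasis_card B) jN; exists k.
Qed.

Lemma sum_bidx_nidx B (V : nmodType) (f : 'I_n -> V) :
  \sum_j f j = \sum_k f (bidx B k) + \sum_k f (nidx B k).
Proof.
rewrite (bigID (mem (bset B))) /= !sum_set_idx; congr (_ + _).
by apply: eq_bigl => j; rewrite inE.
Qed.

Lemma mulmx_bidx_nidx B x :
  A *m x = mxB B *m rowsub (bidx B) x + mxN B *m rowsub (nidx B) x.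
Proof.
apply/matrixP => i j; rewrite !mxE (sum_bidx_nidx B).
by congr (_ + _); apply: eq_bigr => k _; rewrite !mxE.
Qed.

(** Multiply by the inverse of the basis matrix. The right-hand side is left general because [y = b]
    gives the dictionary and [y = 0] describes the kernel of [A]. *)
Lemma solE B (y : 'cV[R]_m) x :
  A *m x = y <->
  rowsub (bidx B) x = invmx (mxB B) *m y - Abar B *m rowsub (nidx B) x.
Proof.
have uB : mxB B \in unitmx by exact: bset_unit.
rewrite (mulmx_bidx_nidx B) /Abar; split=> [<-|->].
  by rewrite mulmxDr mulKmx // mulmxA addrK.
by rewrite mulmxBr mulKVmx // -!mulmxA mulKVmx // subrK.
Qed.

Lemma basic_solB B k : basic_sol b B (bidx B k) 0 = bbar b B k 0.
Proof.
rewrite mxE (bigD1 k) //= big1 ?addr0 // => l /andP[/eqP/bidx_inj ->].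
by rewrite eqxx.
Qed.

Lemma basic_solN B k : basic_sol b B (nidx B k) 0 = 0.
Proof. by rewrite mxE big1 // => l; rewrite bidx_neq_nidx. Qed.

(** Uniqueness of the basic solution: it identifies the point reached by a pivot with the basic
    solution of the new basis. *)
Lemma basic_solP B x :
  A *m x = b -> (forall j, j \notin bset B -> x j 0 = 0) -> x = basic_sol b B.
Proof.
move=> /(solE B) xB xN; apply/matrixP => j l; rewrite ord1.
have xN0 : rowsub (nidx B) x = 0.
  by apply/matrixP => k i; rewrite !mxE ord1 xN // nidx_notin.
case: (bidx_nidxP B j) => -[k ->]; last by rewrite basic_solN xN // nidx_notin.
move: xB => /matrixP/(_ k 0).
by rewrite xN0 mulmx0 subr0 mxE basic_solB => ->.
Qed.

Lemma basic_sol_eq B : A *m basic_sol b B = b.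
Proof.
apply/(solE B); have -> : rowsub (nidx B) (basic_sol b B) = 0.
  by apply/matrixP => k i; rewrite !ord1 mxE basic_solN mxE.
by rewrite mulmx0 subr0; apply/matrixP => k i; rewrite !ord1 mxE basic_solB.
Qed.

Lemma basic_sol_ge0 B : feasible_basis b B <-> nonnegv (basic_sol b B).
Proof.
split=> h j; last by rewrite -basic_solB.
by case: (bidx_nidxP B j) => -[k ->]; rewrite ?basic_solB ?basic_solN.
Qed.

Lemma basic_sol_feasible B :
  feasible_basis b B -> primal_feasible A b (basic_sol b B).
Proof. by move=> /basic_sol_ge0 B0; split=> //; exact: basic_sol_eq. Qed.

Lemma dotvE (q : nat) (u v : 'cV[R]_q) : dotv u v = \sum_i u i 0 * v i 0.
Proof. by rewrite /dotv mxE; apply: eq_bigr => i _; rewrite mxE. Qed.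

(** * Reduced costs and the objective *)

Lemma dual_basic_sB B k : dual_basic_s c B (bidx B k) 0 = 0.
Proof.
have uB : mxB B \in unitmx by exact: bset_unit.
have : rowsub (bidx B) (dual_basic_s c B) = 0.
  have -> : rowsub (bidx B) (dual_basic_s c B) =
      rowsub (bidx B) c - (mxB B)^T *m dual_basic_y c B.
    apply/matrixP => i j; rewrite !mxE; congr (_ - _).
    by apply: eq_bigr => l _; rewrite !mxE.
  by rewrite /dual_basic_y mulKVmx ?unitmx_tr // subrr.
by move=> /matrixP/(_ k 0); rewrite !mxE.
Qed.

Lemma dual_basic_sN B k : dual_basic_s c B (nidx B k) 0 = cbar c B k 0.
Proof.
rewrite /dual_basic_s /cbar -/(dual_basic_y c B) !mxE; congr (_ - _).
by apply: eq_bigr => l _; rewrite !mxE.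
Qed.

(** With [y] and [s = c - A^T y] the dual basic solution, the objective on [A x = b] is
    [y^T b + s^T x], and [s] vanishes on the basis. The constant [y^T b] is eliminated by evaluating
    at the basic solution. *)
Lemma dotv_reduced B x :
  A *m x = b ->
  dotv c x = dotv c (basic_sol b B) + \sum_k cbar c B k 0 * x (nidx B k) 0.
Proof.
have key z : A *m z = b -> dotv c z = ((dual_basic_y c B)^T *m b) 0 0 +
    \sum_k cbar c B k 0 * z (nidx B k) 0.
  move=> zb; have -> : dotv c z =
      ((dual_basic_y c B)^T *m b) 0 0 + dotv (dual_basic_s c B) z.
    rewrite /dotv /dual_basic_s linearB /= mulmxBl.
    rewrite -zb [(A^T *m _)^T]trmx_mul trmxK -!mulmxA.
    by rewrite [X in _ + X]mxE [X in _ + (_ + X)]mxE addrC subrK.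
  congr (_ + _); rewrite dotvE (sum_bidx_nidx B) big1 ?add0r => [|k _].
    by apply: eq_bigr => k _; rewrite dual_basic_sN.
  by rewrite dual_basic_sB mul0r.
move=> xb; rewrite (key _ xb) (key _ (basic_sol_eq B)).
by rewrite [X in _ + X + _]big1 ?addr0 // => k _; rewrite basic_solN mulr0.
Qed.


(** The edge of [s] is parametrized by arbitrary [t], without asking for feasibility: a pivot takes
    [t] from the ratio test, the unboundedness argument takes a large [t]. *)
Lemma edge_point B (s : 'I_(n - m)) (t : R) :
  exists x, [/\ A *m x = b,
    forall k, x (bidx B k) 0 = bbar b B k 0 - t * Abar B k s,
    forall k, x (nidx B k) 0 = t * (k == s)%:R &
    dotv c x = dotv c (basic_sol b B) + t * cbar c B s 0].
Proof.
pose u k := bbar b B k 0 - t * Abar B k s.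
pose w k : R := t * (k == s)%:R.
pose x : 'cV[R]_n := \col_j (\sum_(k | bidx B k == j) u k +
                             \sum_(k | nidx B k == j) w k).
have xB k : x (bidx B k) 0 = u k.
  rewrite mxE [X in _ + X]big1 => [|l]; last by rewrite eq_sym bidx_neq_nidx.
  rewrite addr0 (bigD1 k) //= big1 ?addr0 // => l /andP[/eqP/bidx_inj ->].
  by rewrite eqxx.
have xN k : x (nidx B k) 0 = w k.
  rewrite mxE big1 => [|l]; last by rewrite bidx_neq_nidx.
  rewrite add0r (bigD1 k) //= big1 ?addr0 // => l /andP[/eqP/nidx_inj ->].
  by rewrite eqxx.
have sum_w (f : 'I_(n - m) -> R) : \sum_k f k * w k = t * f s.
  rewrite (bigD1 s) //= big1 ?addr0 => [|k /negPf ks]; rewrite /w ?ks ?eqxx.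
    by rewrite mulr1 mulrC.
  by rewrite !mulr0.
have xb : A *m x = b.
  apply/(solE B)/matrixP => k i; rewrite ord1 [LHS]mxE xB.
  rewrite [RHS]mxE [X in _ = _ + X]mxE [X in _ = _ - X]mxE; congr (_ - _).
  by rewrite -sum_w; apply: eq_bigr => l _; rewrite [rowsub _ _ _ _]mxE xN.
exists x; split=> //; rewrite (dotv_reduced B xb) -(sum_w (fun k => cbar c B k 0)).
by congr (_ + _); apply: eq_bigr => k _; rewrite xN.
Qed.

(** * Basis exchange and pivots *)

Lemma exchange_card B s r : #|exchange B s r| = m.
Proof.
rewrite /exchange cardsU1 !inE negb_and nidx_notin orbT /=.
by have := cardsD1 (bidx B r) (bset B); rewrite bidx_in bset_card => <-.
Qed.

(** A kernel vector of the new basis matrix, extended by zero, is some [x] with [A x = 0]. Its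
    leaving entry is zero, so row [r] of the dictionary gives [Abar r s * x_s = 0]; hence the
    entering entry vanishes, and with it all of [x]. *)
Lemma exchange_unit B s r : Abar B r s != 0 ->
  colsub (set_idx (exchange_card B s r)) A \in unitmx.
Proof.
move=> ars; apply: unitmx_inj => v Mv0.
set f := set_idx _ in Mv0 *.
pose x : 'cV[R]_n := \col_j \sum_(k | f k == j) v k 0.
have xf k : x (f k) 0 = v k 0.
  rewrite mxE (bigD1 k) //= big1 ?addr0 // => l /andP[/eqP/set_idx_inj ->].
  by rewrite eqxx.
have x0 j : j \notin exchange B s r -> x j 0 = 0.
  move=> jE; rewrite mxE big1 // => k /eqP fk.
  by move: jE; rewrite -fk set_idx_in.
clearbody x.
have Ax : A *m x = 0.
  rewrite -Mv0; apply/matrixP => i j; rewrite mxE [RHS]mxE ord1.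
  rewrite (bigID (mem (exchange B s r))) /= [X in _ + X]big1 ?addr0; last first.
    by move=> k kE; rewrite x0 // mulr0.
  rewrite -(sum_set_idx (exchange_card B s r)); apply: eq_bigr => k _.
  by rewrite mxE xf.
have xN k : k != s -> x (nidx B k) 0 = 0.
  move=> ks; rewrite x0 // !inE (negPf (nidx_notin B k)) andbF orbF.
  by rewrite (inj_eq (@nidx_inj B)).
have xB k : x (bidx B k) 0 = - (Abar B k s * x (nidx B s) 0).
  move: Ax => /(solE B)/matrixP/(_ k 0); rewrite mulmx0 sub0r [LHS]mxE => ->.
  rewrite [LHS]mxE [X in - X]mxE; congr (- _).
  rewrite (bigD1 s) //= big1 ?addr0 => [|l ls]; first by rewrite [rowsub _ _ _ _]mxE.
  by rewrite [rowsub _ _ _ _]mxE xN // mulr0.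
have xs : x (nidx B s) 0 = 0.
  have /esym/eqP := xB r; rewrite (x0 (bidx B r)) ?oppr_eq0 ?mulf_eq0 ?(negPf ars) => [/eqP //|].
  by rewrite !inE eqxx bidx_neq_nidx.
apply/matrixP => k i; rewrite ord1 -xf mxE.
case: (bidx_nidxP B (f k)) => -[l ->]; first by rewrite xB xs mulr0 oppr0.
by have [->//|/xN] := eqVneq l s.
Qed.

Definition exchange_basis B s r (ars : Abar B r s != 0) : lp_basis A :=
  Basis (exchange_unit ars).

(** The edge point at [theta] vanishes outside the exchanged set, so it is the new basic solution;
    the ratio test keeps it nonnegative. *)
Lemma pivot B s r : feasible_basis b B -> leaving b B s r ->
  let theta := bbar b B r 0 / Abar B r s in
  exists B', [/\ bset B' = exchange B s r, feasible_basis b B',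
    forall k, basic_sol b B' (bidx B k) 0 = bbar b B k 0 - theta * Abar B k s,
    basic_sol b B' (nidx B s) 0 = theta &
    dotv c (basic_sol b B') = dotv c (basic_sol b B) + theta * cbar c B s 0].
Proof.
move=> Bf [ars rmin] theta; have ars0 := lt0r_neq0 ars.
have [x [xb xB xN cx]] := edge_point B s theta.
have theta0 : 0 <= theta by rewrite divr_ge0 // ltW.
exists (exchange_basis ars0); suff xE : x = basic_sol b (exchange_basis ars0).
  split=> //; rewrite -?xE //; last by rewrite xN eqxx mulr1.
  apply/basic_sol_ge0; rewrite -xE => j.
  case: (bidx_nidxP B j) => -[k ->]; last by rewrite xN mulr_ge0 ?ler0n.
  rewrite xB subr_ge0; have [aks|aks] := ltP 0 (Abar B k s).
    by rewrite -ler_pdivlMr // rmin.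
  by rewrite (le_trans _ (Bf k)) // mulr_ge0_le0.
apply: basic_solP => // j; rewrite !inE negb_or negb_and negbK.
case: (bidx_nidxP B j) => -[k ->].
  rewrite bidx_in orbF => /andP[_ /eqP/bidx_inj ->].
  by rewrite xB divfK // subrr.
by rewrite (inj_eq (@nidx_inj B)) xN => /andP[/negPf -> _]; rewrite mulr0.
Qed.

(* Otherwise the objective decreases without bound along the edge of s. *)
Lemma leaving_exists B s (z : R) : feasible_basis b B -> cbar c B s 0 < 0 ->
  (forall x, primal_feasible A b x -> z <= dotv c x) ->
  exists r, leaving b B s r.
Proof.
move=> Bf cs zmin.
have [r ars|noa] := pickP (fun r => 0 < Abar B r s).
  case: (@arg_minP _ _ _ r [pred k | 0 < Abar B k s]
    (fun k => bbar b B k 0 / Abar B k s) ars) => i ai imin.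
  by exists i.
(* This step length brings the objective down to exactly [z - 1], below the lower bound [z]. *)
pose t := (dotv c (basic_sol b B) - z + 1) / - cbar c B s 0.
have t0 : 0 <= t.
  rewrite divr_ge0 // ?oppr_ge0 ?(ltW cs) // addr_ge0 // subr_ge0 zmin //.
  exact: basic_sol_feasible.
have [x [xb xB xN cx]] := edge_point B s t.
have /zmin : primal_feasible A b x.
  split=> // j; case: (bidx_nidxP B j) => -[k ->].
    rewrite xB subr_ge0 (le_trans _ (Bf k)) // mulr_ge0_le0 //.
    by rewrite leNgt noa.
  by rewrite xN mulr_ge0 ?ler0n.
rewrite cx /t invrN mulrN mulNr divfK; last exact: ltr0_neq0.
lra.
Qed.

(** * Optimality and the sign of the reduced costs *)

Lemma cbar_ge0_optimal B : feasible_basis b B -> nonnegv (cbar c B) ->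
  primal_optimal A b c (basic_sol b B).
Proof.
move=> Bf c0; split; first exact: basic_sol_feasible.
move=> x [xb x0]; rewrite (dotv_reduced B xb) lerDl sumr_ge0 // => k _.
by rewrite mulr_ge0.
Qed.

(** A negative reduced cost would allow a pivot whose step is positive by nondegeneracy, hence a
    strict decrease. Thus the stopping test succeeds at every optimal basis. *)
Lemma optimal_cbar_ge0 B : nondegenerate_lp A b -> feasible_basis b B ->
  primal_optimal A b c (basic_sol b B) -> nonnegv (cbar c B).
Proof.
move=> nd Bf [_ opt] s; rewrite leNgt; apply/negP => cs.
have [r lr] := leaving_exists Bf cs opt.
have [B' [_ B'f _ _ cB']] := pivot Bf lr.
have := opt _ (basic_sol_feasible B'f).
rewrite cB' lerDl leNgt nmulr_llt0 // divr_gt0 //; last by case: lr.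
by have := nd B Bf r; rewrite basic_solB.
Qed.

End DictionaryTheory.

(** * Estimates for a single iteration *)

Section Descent.
Context (R : realType) (p : R) (m n : nat) (A : 'M[R]_(m, n)).
Context (b : 'cV[R]_m) (c : 'cV[R]_n) (gamma delta z : R).
Hypothesis p_gt0 : 0 < p.
Hypothesis delta_gt0 : 0 < delta.
Hypothesis bfs_le : forall (B : lp_basis A) j,
  feasible_basis b B -> basic_sol b B j 0 <= gamma.
Hypothesis bfs_ge : forall (B : lp_basis A) j,
  feasible_basis b B -> 0 < basic_sol b B j 0 -> delta <= basic_sol b B j 0.
Hypothesis nondeg : nondegenerate_lp A b.
Hypothesis z_min : forall x, primal_feasible A b x -> z <= dotv c x.
Implicit Types B : lp_basis A.

Lemma pnorm_Vmx B k :
  pnorm p (col k (Vmx B)) = (1 + \sum_i `|Abar B i k| `^ p) `^ p^-1.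
Proof.
rewrite /pnorm big_split_ord /= addrC; congr ((_ + _) `^ _).
  rewrite (bigD1 k) //= big1 => [|l /negPf lk]; rewrite mxE col_mxEd mxE.
    by rewrite eqxx normr1 powR1 addr0.
  by rewrite lk normr0 powR0 // gt_eqF.
by apply: eq_bigr => i _; rewrite mxE col_mxEu mxE normrN.
Qed.

Lemma pnorm_Vmx_gt0 B k : 0 < pnorm p (col k (Vmx B)).
Proof. by rewrite pnorm_Vmx powR_gt0 // ltr_pwDl // sumr_ge0. Qed.

Lemma bbar_ge B k : feasible_basis b B -> delta <= bbar b B k 0.
Proof.
by move=> Bf; rewrite -basic_solB bfs_ge //; exact: nondeg.
Qed.

(** The step length is the value of the entering variable in the next BFS, and it is positive by
    nondegeneracy. *)
Lemma step_ge B s r : feasible_basis b B -> leaving b B s r ->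
  delta <= bbar b B r 0 / Abar B r s.
Proof.
move=> Bf lr; have [B' [_ B'f _ xs _]] := pivot c Bf lr.
rewrite -xs bfs_ge // xs.
rewrite divr_gt0 //; last by case: lr.
exact: lt_le_trans (bbar_ge _ Bf).
Qed.

(** A hypothetical pivot on column [k] changes the basic variable [i] by [theta * Abar i k]. Its old
    and new values lie in [[0, gamma]], and [theta] is at least [delta]. *)
Lemma Abar_le B i k : feasible_basis b B -> cbar c B k 0 < 0 ->
  `|Abar B i k| <= gamma / delta.
Proof.
move=> Bf ck; have [r lr] := leaving_exists Bf ck z_min.
have dt := step_ge Bf lr; have [B' [_ B'f xB _ _]] := pivot c Bf lr.
move: xB dt; set theta := _ / _ => xB dt.
rewrite ler_pdivlMr // (@le_trans _ _ (`|Abar B i k| * theta)) //.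
  by rewrite ler_wpM2l.
have theta0 : 0 < theta by exact: lt_le_trans dt.
rewrite -[X in _ * X]gtr0_norm // -normrM mulrC ler_norml.
have x1 := bfs_le (bidx B i) Bf; rewrite basic_solB in x1.
have x2 := bfs_le (bidx B i) B'f; rewrite xB in x2.
have x3 := Bf i; have /basic_sol_ge0 /(_ (bidx B i)) x4 := B'f; rewrite xB in x4.
by apply/andP; split; lra.
Qed.

Lemma gamma_ge_delta B : feasible_basis b B -> (0 < m)%N -> delta <= gamma.
Proof.
move=> Bf m0; rewrite (le_trans (bbar_ge (Ordinal m0) Bf)) //.
by rewrite -basic_solB bfs_le.
Qed.

(** The [m] entries of the column and the extra 1 each contribute at most [(gamma / delta) ^ p]; for
    the latter, [gamma / delta] is at least 1. *)
Lemma pnorm_le B k : feasible_basis b B -> (0 < m)%N -> cbar c B k 0 < 0 ->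
  pnorm p (col k (Vmx B)) <= m.+1%:R `^ p^-1 * (gamma / delta).
Proof.
move=> Bf m0 ck; have dg := gamma_ge_delta Bf m0.
have D1 : 1 <= gamma / delta by rewrite ler_pdivlMr ?mul1r.
have D0 : 0 <= gamma / delta by exact: le_trans D1.
have DE : gamma / delta = ((gamma / delta) `^ p) `^ p^-1.
  by rewrite -powRrM mulfV ?powRr1 ?gt_eqF.
rewrite pnorm_Vmx [X in _ * X]DE -powRM ?powR_ge0 ?ler0n //.
have Dp : 1 <= (gamma / delta) `^ p.
  by rewrite -[leLHS](powRr0 (gamma / delta)) ler_powR // ltW.
apply: ge0_ler_powR; rewrite ?invr_ge0 ?nnegrE ?(ltW p_gt0) //.
- by rewrite addr_ge0 // sumr_ge0 // => i _; exact: powR_ge0.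
- by rewrite mulr_ge0 ?ler0n ?powR_ge0.
rewrite -natr1 mulrDl mul1r addrC lerD //.
apply: (@le_trans _ _ (\sum_(i < m) (gamma / delta) `^ p)).
  apply: ler_sum => i _; apply: ge0_ler_powR; rewrite ?nnegrE ?(ltW p_gt0) //.
  exact: Abar_le.
by rewrite sumr_const card_ord mulr_natl.
Qed.

(* Both the entering and the leaving variable change by at least delta. *)
Lemma step_pnorm_ge B s r : feasible_basis b B -> leaving b B s r ->
  2 `^ p^-1 * delta <=
  bbar b B r 0 / Abar B r s * pnorm p (col s (Vmx B)).
Proof.
move=> Bf lr; have dt := step_ge Bf lr; have [ars _] := lr.
have br := bbar_ge r Bf; have p0 := ltW p_gt0; have d0 := ltW delta_gt0.
set theta := _ / _ in dt *; have t0 : 0 <= theta by exact: le_trans dt.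
have pK u : 0 <= u -> u = (u `^ p) `^ p^-1.
  by move=> u0; rewrite -powRrM mulfV ?powRr1 // gt_eqF.
rewrite pnorm_Vmx [X in X * (_ `^ _)]pK // [X in _ * X]pK //.
have S0 : 0 <= \sum_i `|Abar B i s| `^ p.
  by rewrite sumr_ge0 // => i _; exact: powR_ge0.
rewrite -!powRM ?powR_ge0 ?addr_ge0 //.
apply: ge0_ler_powR; rewrite ?invr_ge0 ?nnegrE ?mulr_ge0 ?powR_ge0 ?addr_ge0 //.
rewrite mulrDr mulr1 mulr_natl mulr2n lerD ?ge0_ler_powR ?nnegrE //.
(* Only the term of the leaving variable is kept: it drops by [theta * Abar r s], its whole value
   [bbar r], which is at least [delta]. *)
apply: (@le_trans _ _ (theta `^ p * `|Abar B r s| `^ p)).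
  rewrite -powRM // gtr0_norm // divfK ?gt_eqF //.
  by rewrite ge0_ler_powR ?nnegrE // (le_trans d0).
by rewrite ler_wpM2l ?powR_ge0 // (bigD1 r) //= lerDl sumr_ge0.
Qed.

(** All entries are nonnegative, so the sum extends to all indices, where only the [m] basic ones of
    [B'] contribute. *)
Lemma sum_nonbasic_le B (B' : lp_basis A) : feasible_basis b B' ->
  \sum_k basic_sol b B' (nidx B k) 0 <= m%:R * gamma.
Proof.
move=> B'f; have x0 := (basic_sol_ge0 b B').1 B'f.
apply: (@le_trans _ _ (\sum_j basic_sol b B' j 0)).
  by rewrite (sum_bidx_nidx B) lerDr sumr_ge0.
rewrite (sum_bidx_nidx B') [X in _ + X]big1 ?addr0 => [|k _]; last first.
  exact: basic_solN.
apply: (@le_trans _ _ (\sum_(k < m) gamma)).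
  by apply: ler_sum => k _; exact: bfs_le.
by rewrite sumr_const card_ord mulr_natl.
Qed.

(** The gap is expanded in the dictionary of [B] at the optimal solution. Its bound and the decrease
    [q * (theta * N s)] share the factor [q], minus the minimal ratio, so the claim reduces to one
    about [gamma], [delta] and [m]. *)
Lemma descent B (Bopt : lp_basis A) s r : (0 < m)%N ->
  feasible_basis b B -> feasible_basis b Bopt ->
  dotv c (basic_sol b Bopt) = z ->
  pnorm_entering c B p s -> leaving b B s r ->
  dotv c (basic_sol b B) - z <=
    m%:R `^ (1 + p^-1) * (gamma ^+ 2 / delta ^+ 2) *
    - (bbar b B r 0 / Abar B r s * cbar c B s 0).
Proof.
move=> m0 Bf Bof co [cs smin] lr.
have dg := gamma_ge_delta Bf m0; have g0 := le_trans (ltW delta_gt0) dg.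
set M := m.+1%:R `^ p^-1 * (gamma / delta).
have M0 : 0 <= M by rewrite mulr_ge0 ?powR_ge0 ?divr_ge0 // ltW.
have step := step_pnorm_ge Bf lr; set theta := _ / _ in step *.
set N := fun k => pnorm p (col k (Vmx B)).
have N0 k : 0 < N k by exact: pnorm_Vmx_gt0.
set q := - (cbar c B s 0 / N s).
have q0 : 0 <= q by rewrite /q oppr_ge0 pmulr_lle0 ?invr_gt0 // ltW.
(* Minimality of the ratio at [s] gives [- cbar k <= q * N k]. The bound on [N k] requires [cbar k]
   to be negative; otherwise the left side is at most 0. *)
have cM k : - cbar c B k 0 <= q * M.
  have [ck|ck] := leP 0 (cbar c B k 0).
    by apply: (@le_trans _ _ 0); [rewrite oppr_le0 | exact: mulr_ge0].
  apply: (@le_trans _ _ (q * N k)); last by rewrite ler_wpM2l // pnorm_le.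
  by rewrite /q mulNr lerN2 -(ler_pdivlMr _ _ (N0 k)); exact: smin.
have xo0 := (basic_sol_ge0 b Bopt).1 Bof.
have -> : dotv c (basic_sol b B) - z =
    \sum_k - cbar c B k 0 * basic_sol b Bopt (nidx B k) 0.
  rewrite -co (dotv_reduced c B (basic_sol_eq b Bopt)) opprD addNKr -sumrN.
  by apply: eq_bigr => k _; rewrite mulNr.
apply: (@le_trans _ _ (q * M * (m%:R * gamma))).
  apply: (@le_trans _ _ (q * M * \sum_k basic_sol b Bopt (nidx B k) 0)).
    by rewrite mulr_sumr ler_sum // => k _; rewrite ler_wpM2r.
  by apply: ler_wpM2l; [exact: mulr_ge0 | exact: sum_nonbasic_le].
have -> : - (theta * cbar c B s 0) = q * (theta * N s).
  by rewrite /q -mulrN mulrCA mulNr divfK // gt_eqF.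
rewrite -mulrA [leRHS]mulrCA ler_wpM2l //.
have K0 : 0 <= m%:R `^ (1 + p^-1) * (gamma ^+ 2 / delta ^+ 2).
  by rewrite mulr_ge0 ?powR_ge0 ?divr_ge0 ?exprn_ge0 // ltW.
apply: le_trans (ler_wpM2l K0 step).
rewrite powRD; last by rewrite pnatr_eq0 -lt0n m0 implybT.
rewrite powRr1 ?ler0n // /M.
(* Merging the powers into [(m * 2) ^ (1/p)] leaves only [m + 1 <= 2 m] to check. *)
have -> : m%:R * m%:R `^ p^-1 * (gamma ^+ 2 / delta ^+ 2) *
    (2 `^ p^-1 * delta) =
  (m%:R * 2) `^ p^-1 * (gamma / delta * (m%:R * gamma)).
  by rewrite powRM ?ler0n //; field; rewrite gt_eqF.
rewrite -[leLHS]mulrA ler_wpM2r ?mulr_ge0 ?invr_ge0 ?(ltW delta_gt0) //.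
apply: ge0_ler_powR; rewrite ?nnegrE ?invr_ge0 ?mulr_ge0 ?ler0n ?(ltW p_gt0) //.
by rewrite -natrM ler_nat muln2 -addnn -addn1 leq_add2l.
Qed.

(** A minimizer of the ratio over all columns has negative reduced cost, since some ratio is
    negative and the norms are positive. *)
Lemma entering_exists B : ~ nonnegv (cbar c B) -> exists s, pnorm_entering c B p s.
Proof.
move=> c0; have [k ck|c0'] := pickP (fun k => cbar c B k 0 < 0); last first.
  by case: c0 => k; rewrite leNgt c0'.
case: (@arg_minP _ _ _ k xpredT
  (fun k => cbar c B k 0 / pnorm p (col k (Vmx B))) isT) => s _ smin.
have N0 l := pnorm_Vmx_gt0 B l.
exists s; split=> [|l]; last exact: smin.
have := smin k isT; rewrite leNgt => h; rewrite ltNge; apply: contra h => cs.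
by rewrite (@lt_le_trans _ _ 0) ?divr_ge0 // ?pmulr_llt0 ?invr_gt0 // ltW.
Qed.

End Descent.

(** * Counting the iterations *)

Lemma geometric_decay (R : realType) (K u v : R) (k : nat) :
  1 <= K -> 0 < u -> 0 < v -> (0 < k)%N -> K * ln (u / v) <= k%:R ->
  (1 - K^-1) ^+ k * u < v.
Proof.
move=> K1 u0 v0 k0 Kk; have K0 : 0 < K by exact: lt_le_trans K1.
rewrite -ltr_pdivlMr //.
(* The inequality [1 - 1/K < exp (-1/K)] is strict, and stays strict after taking the [k]-th power
   because [k] is positive. *)
apply: (@lt_le_trans _ _ (expR (- K^-1) ^+ k)).
  rewrite ltrXn2r ?gtn_eqF // ?subr_ge0 ?invf_le1 ?expR_ge0 //.
  by apply: expR_gt1Dx; rewrite oppr_eq0 invr_eq0 gt_eqF.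
rewrite -expRM_natl -[leRHS]lnK ?posrE ?divr_gt0 // ler_expR.
rewrite -[v / u]invf_div lnV ?posrE ?divr_gt0 // mulrN lerN2.
by rewrite ler_pdivlMr // mulrC.
Qed.

(* The bound is the ceiling, except that it reads 1 when the ceiling is 0, which
   happens exactly when x0 is itself a second optimal BFS: x0 is not optimal,
   so one iteration is then needed (and suffices). *)
Theorem theorem7 (R : realType) (p : R) (m n : nat)
  (A : 'M[R]_(m, n)) (b : 'cV[R]_m) (c x0 xbar : 'cV[R]_n)
  (zstar gamma delta : R)
  (p_ge1 : 1 <= p)
  (rankA : \rank A = m)
  (x0_bfs : bfs A b x0)
  (primal_opt : exists B : lp_basis A,
     primal_optimal A b c (basic_sol b B) /\ dotv c (basic_sol b B) = zstar)
  (dual_opt : exists B : lp_basis A,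
     dual_optimal A b c (dual_basic_y c B) (dual_basic_s c B) /\
     dotv b (dual_basic_y c B) = zstar)
  (x0_not_opt : zstar < dotv c x0)
  (nondeg : nondegenerate_lp A b)
  (gammaP : maximum (bfs_positive_components A b) gamma)
  (deltaP : minimum (bfs_positive_components A b) delta)
  (xbarP : second_optimal_bfs A b c xbar) :
  forall B0 : lp_basis A, feasible_basis b B0 -> basic_sol b B0 = x0 ->
    finds_optimum_within b c p
      (maxn 1 `|Num.ceil (m%:R `^ (1 + p^-1) * (gamma ^+ 2 / delta ^+ 2) *
                 ln ((dotv c x0 - zstar) / (dotv c xbar - zstar)))|%N)
      B0.
Proof.
have p_gt0 : 0 < p by exact: lt_le_trans p_ge1.
have [[gamma_gt0 [_ [j [[B1 [_ ->]] gE]]]] gamma_ub] := gammaP.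
have [[delta_gt0 _] delta_lb] := deltaP.
(* For [m = 0] every entry of a basic solution is an empty sum, whereas [gamma] is a positive
   entry. *)
have m_gt0 : (0 < m)%N.
  move: gamma_gt0; rewrite gE mxE => g0; rewrite lt0n; apply/eqP => m0.
  by move: g0; rewrite big1 ?ltxx // => k; have := ltn_ord k; rewrite {2}m0.
have bfs_le (B : lp_basis A) i : feasible_basis b B ->
    basic_sol b B i 0 <= gamma.
  move=> Bf; have [xi|xi] := ltP 0 (basic_sol b B i 0).
    by apply: gamma_ub; split=> //; exists (basic_sol b B), i; split=> //; exists B.
  exact: le_trans xi (ltW gamma_gt0).
have bfs_ge (B : lp_basis A) i : feasible_basis b B ->
    0 < basic_sol b B i 0 -> delta <= basic_sol b B i 0.
  move=> Bf xi; apply: delta_lb.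
  by split=> //; exists (basic_sol b B), i; split=> //; exists B.
have [Bopt [[opt_feas opt_min] opt_val]] := primal_opt.
have Bopt_f : feasible_basis b Bopt by apply/basic_sol_ge0; case: opt_feas.
have z_min x : primal_feasible A b x -> zstar <= dotv c x.
  by rewrite -opt_val; exact: opt_min.
have not_opt x : primal_feasible A b x -> zstar < dotv c x <->
    ~ primal_optimal A b c x.
  move=> xf; split=> [zx [_ /(_ _ opt_feas)]|xno].
    by rewrite opt_val leNgt zx.
  rewrite ltNge; apply/negP => xz; apply: xno; split=> // x' /z_min.
  exact: le_trans.
have [xbar_bfs xbar_no xbar_min] := xbarP.
have xbar_gt : zstar < dotv c xbar.
  apply/not_opt => //; case: xbar_bfs => B [Bf ->].
  exact: basic_sol_feasible.
have dg := gamma_ge_delta bfs_le bfs_ge nondeg Bopt_f m_gt0.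
set K := m%:R `^ (1 + p^-1) * (gamma ^+ 2 / delta ^+ 2).
have K_ge1 : 1 <= K.
  rewrite /K -[leLHS]mulr1 ler_pM //.
    rewrite -[leLHS](powRr0 m%:R) ler_powR ?ler1n //.
    by rewrite addr_ge0 ?invr_ge0 // ltW.
  by rewrite ler_pdivlMr ?exprn_gt0 // mul1r lerXn2r ?nnegrE // ltW.
have K_gt0 : 0 < K by exact: lt_le_trans K_ge1.
(* Induction on the iteration budget, over all feasible bases. With budget 0 the gap is below that
   of [xbar], the smallest among non-optimal BFSs, so the basis is optimal. *)
have within k : forall B : lp_basis A, feasible_basis b B ->
    (1 - K^-1) ^+ k * (dotv c (basic_sol b B) - zstar) < dotv c xbar - zstar ->
    finds_optimum_within b c p k B.
  elim: k => [|k IHk] B Bf.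
    rewrite expr0 mul1r ltrD2r => Bx; left.
    have Bo : primal_optimal A b c (basic_sol b B).
      apply: contrapT => Bno; move: Bx; rewrite ltNge xbar_min //.
      by exists B.
    by split=> //; exact: optimal_cbar_ge0 Bo.
  move=> Bx; have [c0|c0] := pselect (nonnegv (cbar c B)).
    by left; split=> //; exact: cbar_ge0_optimal.
  right; split; first exact: entering_exists.
    by move=> s [cs _]; exact: leaving_exists Bf cs z_min.
  move=> s r es lr; have [B' [B'E B'f _ _ cB']] := pivot c Bf lr.
  exists B' => //; apply: IHk => //; apply: le_lt_trans Bx.
  rewrite exprSr -mulrA ler_wpM2l ?exprn_ge0 ?subr_ge0 ?invf_le1 //.
  (* This bounds the old gap by [K] times the difference of old and new gaps, so the new gap is at
     most [1 - 1/K] times the old one. *)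
  have := descent p_gt0 delta_gt0 bfs_le bfs_ge nondeg z_min m_gt0 Bf Bopt_f
    opt_val es lr.
  by rewrite -/K -ler_pdivrMl // cB' mulrBl mul1r; lra.
move=> B0 B0f B0x; apply: within => //; rewrite B0x.
(* The [maxn 1] supplies the positive exponent required for strict decay. *)
apply: geometric_decay; rewrite ?subr_gt0 ?leq_max //.
set v := K * _; apply: (le_trans (ceil_ge v)).
apply: (@le_trans _ _ (`|Num.ceil v|%N%:R)); last by rewrite ler_nat leq_maxr.
by rewrite natr_absz ler_int ler_norm.
Qed.
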